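(* Let $\pi = \{I_1,\ldots,I_m\}$ be a partition of $\{1,\ldots,N\}$, where $N\ge1$. Given $A \in \overline{\mathcal{S}_\pi}$ and $B\in\mathbb{C}^{m\times m}$, define the resolvents \[ R(z;A) := (z 1_{\overline{\mathcal{S}_\pi}} - A)^{-1} \quad\text{(inverse in } \overline{\mathcal{S}_\pi}) \quad\text{for all } z\in\mathbb{C}\setminus\sigma(A;\overline{\mathcal{S}_\pi}) \] and \[ R(z;B) := (z\,\mathrm{Id}_m - B)^{-1}\quad\text{for all } z\in\mathbb{C}\setminus\sigma(B;\mathbb{C}^{m\times m}) = \mathbb{C}\setminus\sigma(B). \] If $z \notin \sigma(A;\overline{\mathcal{S}_\pi}) = \sigma(\Theta^\downarrow_\pi(A);\mathbb{C}^{m\times m}) = \sigma(\Theta^\downarrow_\pi(A))$, then \[ \Theta^\downarrow_\pi(R(z;A)) = R(z;\Theta^\downarrow_\pi(A)). \] Thus the holomorphic functional calculus transfers between $\mathbb{C}^{m\times m}$ and $\overline{\mathcal{S}_\pi}$: if $A\in\overline{\mathcal{S}_\pi}$ and $f$ is holomorphic on an open set containing $\sigma(A;\overline{\mathcal{S}_\pi})$, then \[ f(A)\in\overline{\mathcal{S}_\pi}\qquad\text{and}\qquad \Theta^\downarrow_\pi(f(A)) = f(\Theta^\downarrow_\pi(A)). \]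
   Context: $\overline{\mathcal{S}_\pi}$ is the closure of the set $\mathcal{S}_\pi$ of matrices $A\in\mathbb{C}^{N\times N}$ for which $\pi$ is the coarsest partition such that $A$ is constant on each block $I_i\times I_j$; equivalently, $\overline{\mathcal{S}_\pi}$ is the set of all $A\in\mathbb{C}^{N\times N}$ constant on each block $I_i\times I_j$. With the usual matrix multiplication it is a unital algebra with unit $1_{\overline{\mathcal{S}_\pi}} = \sum_{k=1}^m |I_k|^{-1}\mathbf{1}_{I_k\times I_k}$, where $\mathbf{1}_{I_k\times I_k}$ is the $N\times N$ matrix with entries $1$ on $I_k\times I_k$ and $0$ elsewhere. For a complex unital algebra $\mathcal{A}$ and $a\in\mathcal{A}$, $\sigma(a;\mathcal{A}) := \{\lambda\in\mathbb{C} : \lambda 1_{\mathcal{A}} - a \text{ is not invertible in } \mathcal{A}\}$; $\sigma(B)$ is the usual spectrum of a square matrix. The matrix $\mathcal{W}_\pi\in\mathbb{C}^{N\times m}$ has $(i,j)$ entry $1$ if $i\in I_j$ and $0$ otherwise, $D_\pi := \operatorname{diag}(|I_1|,\ldots,|I_m|)$, and $\Theta^\downarrow_\pi(A) := D_\pi^{-1/2}\mathcal{W}_\pi^*A\mathcal{W}_\pi D_\pi^{-1/2}\in\mathbb{C}^{m\times m}$ for $A \in \mathbb{C}^{N\times N}$. Here $f(A)$ is defined by the holomorphic functional calculus in the algebra $\overline{\mathcal{S}_\pi}$, that is, $f(A) = \frac{1}{2\pi \mathrm{i}}\oint f(z)R(z;A)\,\mathrm{d}z$ over a contour in the domain of $f$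 surrounding $\sigma(A;\overline{\mathcal{S}_\pi})$ once, and $f(\Theta^\downarrow_\pi(A))$ by the usual holomorphic functional calculus in $\mathbb{C}^{m\times m}$. *)

(* Defs.v *)
From Stdlib Require List.
From HB Require Import structures.
From mathcomp Require Import all_boot all_order all_algebra complex.
From mathcomp Require Import all_classical all_reals all_analysis.
Set Implicit Arguments.
Unset Strict Implicit.
Unset Printing Implicit Defensive.
Import Order.TTheory GRing.Theory Num.Theory.
Import numFieldNormedType.Exports.
Local Open Scope classical_set_scope.
Local Open Scope ring_scope.

(* The complex field R[i], packed as a [numClosedFieldType] so that it (and
   matrices over it) receive the topology and the norm of MathComp-Analysis. *)
Definition Cplx (R : realType) : numClosedFieldType := R[i].

Definition blocks N m (I : 'I_m -> {set 'I_N}) : {set {set 'I_N}} :=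
  imset I (mem [set: 'I_m]%SET).

Definition block_family N m (I : 'I_m -> {set 'I_N}) : Prop :=
  injective I /\ finset.partition (blocks I) [set: 'I_N]%SET.

Definition block_constant (C : Type) N (P : {set {set 'I_N}})
    (A : 'M[C]_N) : Prop :=
  forall I J, I \in P -> J \in P ->
  forall i i' j j', i \in I -> i' \in I -> j \in J -> j' \in J ->
    A i j = A i' j'.

Definition refines (T : finType) (P Q : {set {set T}}) : Prop :=
  forall I, I \in P -> exists2 J, J \in Q & I \subset J.

Definition S_part (C : Type) N (P : {set {set 'I_N}}) : set 'M[C]_N :=
  [set A | block_constant P A /\
     forall Q, finset.partition Q [set: 'I_N]%SET -> block_constant Q A ->
       refines Q P].

Definition Sbar (R : realType) N m (I : 'I_m -> {set 'I_N}) :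
    set 'M[Cplx R]_N :=
  closure (@S_part (Cplx R) N (blocks I)).
Arguments Sbar R {N m} I _.

Definition indic_mx (C : pzRingType) N (I J : {set 'I_N}) : 'M[C]_N :=
  \matrix_(i, j) ((i \in I) && (j \in J))%:R.

Definition Sbar_unit (R : realType) N m (I : 'I_m -> {set 'I_N}) :
    'M[Cplx R]_N :=
  \sum_(k < m) (#|I k|%:R)^-1 *: indic_mx (Cplx R) (I k) (I k).

Definition W_mx (R : realType) N m (I : 'I_m -> {set 'I_N}) :
    'M[Cplx R]_(N, m) :=
  \matrix_(i, j) (i \in I j)%:R.

(* D_pi ^ (-1/2) *)
Definition D_invsqrt (R : realType) N m (I : 'I_m -> {set 'I_N}) :
    'M[Cplx R]_m :=
  diag_mx (\row_k (sqrtC (#|I k|%:R))^-1).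

Definition Theta (R : realType) N m (I : 'I_m -> {set 'I_N})
    (A : 'M[Cplx R]_N) : 'M[Cplx R]_m :=
  D_invsqrt R I *m (map_mx Num.conj (W_mx R I))^T *m A *m W_mx R I
    *m D_invsqrt R I.

(* A unital algebra of matrices is given by
   its carrier [S] and its unit [e], which need not be the identity matrix. *)

Section UnitalAlgebra.
Variables (C : fieldType) (n : nat) (S : set 'M[C]_n) (e : 'M[C]_n).

Definition alg_inverse (x y : 'M[C]_n) : Prop :=
  [/\ S y, x *m y = e & y *m x = e].

Definition alg_spectrum (a : 'M[C]_n) : set C :=
  [set z | ~ exists y, alg_inverse (z *: e - a) y].

Definition alg_resolvent (a : 'M[C]_n) (z : C) : 'M[C]_n :=
  xget 0 [set y | alg_inverse (z *: e - a) y].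

End UnitalAlgebra.

Definition mx_spectrum (C : fieldType) n (B : 'M[C]_n) : set C :=
  [set z | eigenvalue B z].

Definition mx_resolvent (C : fieldType) n (B : 'M[C]_n) (z : C) : 'M[C]_n :=
  invmx (z%:M - B).

Section Contours.
Variable R : realType.
Local Notation C := (Cplx R).

Definition deriv_path (g : R -> C) (t : R) : C :=
  Complex (derive1 (fun s => complex.Re (g s)) t)
          (derive1 (fun s => complex.Im (g s)) t).

(* The arc is the restriction of [g] to [0, 1]. Asking for C^1 on the whole
   line loses nothing: a C^1 function on [0, 1] extends to such a function. *)
Definition C1_path (g : R -> C) : Prop :=
  [/\ forall t, derivable (fun s => complex.Re (g s)) t 1,
      forall t, derivable (fun s => complex.Im (g s)) t 1,
      continuous (derive1 (fun s => complex.Re (g s)))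
    & continuous (derive1 (fun s => complex.Im (g s)))].

(* A finite family of loops, each loop being a list of consecutive arcs. *)
Definition contour : Type := seq (seq (R -> C)).

Definition all_arcs (G : contour) (P : (R -> C) -> Prop) : Prop :=
  forall loop, List.In loop G -> forall g, List.In g loop -> P g.

(* Each loop is a closed piecewise C^1 curve: every arc ends where the next
   one (cyclically) starts. *)
Definition is_contour (G : contour) : Prop :=
  all_arcs G C1_path /\ all (path.cycle (fun g h => g 1 == h 0)) G.

Definition integral01 (F : R -> C) : C :=
  Complex (\int[@lebesgue_measure R]_(t in `[0, 1]) complex.Re (F t))
          (\int[@lebesgue_measure R]_(t in `[0, 1]) complex.Im (F t)).

Definition contour_integral (G : contour) (h : C -> C) : C :=
  \sum_(loop <- G) \sum_(g <- loop)
    integral01 (fun t => h (g t) * deriv_path g t).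

Definition two_pi_i : C := Complex 0 (2 * pi).

Definition winding (G : contour) (w : C) : C :=
  two_pi_i^-1 * contour_integral G (fun z => (z - w)^-1).

(* [G] is a contour in [U] that surrounds [K] once. *)
Definition surrounds (U K : set C) (G : contour) : Prop :=
  [/\ is_contour G,
      all_arcs G (fun g => g @` `[0, 1] `<=` U `\` K),
      forall w, K w -> winding G w = 1
    & forall w, ~ U w -> winding G w = 0].

Definition holomorphic_on (U : set C) (f : C -> C) : Prop :=
  forall z, U z -> derivable (f : C^o -> C^o) z 1.

Definition calculus_integral n (r : C -> 'M[C]_n) (f : C -> C)
    (G : contour) : 'M[C]_n :=
  two_pi_i^-1 *:
    \matrix_(i, j) contour_integral G (fun z => (f z *: r z) i j).

(* The common value of the integrals of [f] times the resolvent [r] over all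
   contours in [U] surrounding the spectrum [K] once. By Cauchy's theorem, they
   all agree when [U] is an open neighbourhood of [K] and [f] is holomorphic on
   [U]. *)
Definition functional_calculus n (K : set C) (r : C -> 'M[C]_n)
    (U : set C) (f : C -> C) : 'M[C]_n :=
  xget 0 [set M | forall G, surrounds U K G -> M = calculus_integral r f G].

Definition alg_calculus n (S : set 'M[C]_n) (e : 'M[C]_n) (U : set C)
    (f : C -> C) (a : 'M[C]_n) : 'M[C]_n :=
  functional_calculus (alg_spectrum S e a) (alg_resolvent S e a) U f.

Definition mx_calculus n (U : set C) (f : C -> C) (B : 'M[C]_n) : 'M[C]_n :=
  functional_calculus (mx_spectrum B) (mx_resolvent B) U f.

End Contours.

(* Main.v *)
Require Import Defs.
From HB Require Import structures.
From mathcomp Require Import all_boot all_order all_algebra complex.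
From mathcomp Require Import all_classical all_reals all_analysis.
From mathcomp Require Import ring lra.
Import Order.TTheory GRing.Theory Num.Theory.
Import numFieldNormedType.Exports.
Local Open Scope classical_set_scope.
Local Open Scope ring_scope.

(** Let [X] be the [N x m] matrix [W D^(-1/2)].  Its columns are the
    normalised indicator vectors of the blocks, so [X^T X = 1] and
    [X X^T = Sbar_unit], and [Theta A = X^T A X].  The map [Lift B = X B X^T]
    goes back: [Theta (Lift B) = B] always, [Lift (Theta A) = A] when [A] is
    constant on blocks, and [Lift] is linear and multiplicative.  Thus [Theta]
    and [Lift] are mutually inverse isomorphisms of unital algebras between
    the block-constant matrices and the full matrix algebra, which yields the
    equality of spectra and the identity of resolvents.  That [Sbar], a closure,
    is the set of block-constant matrices is a density argument: adding to a
    block-constant matrix a small multiple of one whose diagonal values differ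
    from block to block makes the partition the coarsest possible.

    For the functional calculus, the entries of [Lift B] are fixed linear
    combinations of those of [B], so the contour integral of [f] times the
    resolvent of [A] is the [Lift] of the integral for [Theta A], along every
    contour that surrounds the spectrum.  The integrands are continuous on the
    arcs, hence integrable, because a holomorphic function is continuous and
    an inverse matrix is continuous in its entries.

    The calculus is defined as the value shared by all surrounding contours,
    with the default 0.  Since [Lift] is injective, the integrals for [A] agree
    exactly when those for [Theta A] do, and 0 lifts to 0; the two calculi
    therefore correspond as soon as one surrounding contour exists, since
    otherwise the shared value would be arbitrary.  Such a contour is made of
    small circles around the finitely many eigenvalues
    ([exists_surrounding_contour]).  The winding number of a circle is 1 at its
    centre by direct computation, and 0 at an outside point because [z - w] has
    an explicit logarithm along the circle. *)

(** * The isometry attached to a partition *)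

Lemma block_familyP {N m : nat} {I : 'I_m -> {set 'I_N}} : block_family I ->
  [/\ forall k, (0 < #|I k|)%N, forall i, exists k, i \in I k
    & forall i k l, i \in I k -> i \in I l -> k = l].
Proof.
move=> [injI /and3P[/eqP cov tri n0]].
have bI k : I k \in blocks I by apply: imset_f; rewrite inE.
split=> [k|i|i k l ik il].
- by rewrite card_gt0; apply: contra n0 => /eqP <-.
- have : i \in finset.cover (blocks I) by rewrite cov inE.
  by move=> /bigcupP[_ /imsetP[k _ ->] ik]; exists k.
- apply: injI; rewrite -(def_pblock tri (bI k) ik).
  by rewrite -(def_pblock tri (bI l) il).
Qed.

Lemma block_constantP {C : Type} {N m : nat} (I : 'I_m -> {set 'I_N})
    (A : 'M[C]_N) :
  block_constant (blocks I) A <->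
  (forall k l i i' j j', i \in I k -> i' \in I k -> j \in I l -> j' \in I l ->
     A i j = A i' j').
Proof.
split=> [cA k l i i' j j'|cA _ _ /imsetP[k _ ->] /imsetP[l _ ->]].
  by apply: cA; apply: imset_f; rewrite inE.
exact: cA.
Qed.

(** The matrix [W D^(-1/2)], given by entries so that associativity
    rewriting treats it as a single factor. *)
Definition block_isometry (R : realType) (N m : nat) (I : 'I_m -> {set 'I_N}) :
  'M[Cplx R]_(N, m) :=
  \matrix_(i, k) ((i \in I k)%:R * (sqrtC #|I k|%:R)^-1).
Arguments block_isometry R {N m} I.

(** The inverse of [Theta] on block-constant matrices. *)
Definition Lift (R : realType) (N m : nat) (I : 'I_m -> {set 'I_N})
    (B : 'M[Cplx R]_m) : 'M[Cplx R]_N :=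
  block_isometry R I *m B *m (block_isometry R I)^T.
Arguments Lift {R N m} I B.

Lemma block_isometryE (R : realType) (N m : nat) (I : 'I_m -> {set 'I_N}) i k :
  block_isometry R I i k = (i \in I k)%:R * (sqrtC #|I k|%:R)^-1.
Proof. by rewrite mxE. Qed.

Lemma Theta_block_isometry (R : realType) (N m : nat) (I : 'I_m -> {set 'I_N})
    (A : 'M[Cplx R]_N) :
  Theta I A = (block_isometry R I)^T *m A *m block_isometry R I.
Proof.
have WE : map_mx Num.conj (W_mx R I) = W_mx R I.
  by apply/matrixP=> i k; rewrite !mxE conjC_nat.
have DE : (D_invsqrt R I)^T = D_invsqrt R I by rewrite /D_invsqrt tr_diag_mx.
have -> : block_isometry R I = W_mx R I *m D_invsqrt R I.
  by apply/matrixP=> i k; rewrite mul_mx_diag !mxE.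
by rewrite /Theta WE trmx_mul DE !mulmxA.
Qed.

(** The columns of the isometry are orthonormal because the blocks are disjoint
    and nonempty. *)
Lemma block_isometryTM (R : realType) (N m : nat) (I : 'I_m -> {set 'I_N}) :
  block_family I -> (block_isometry R I)^T *m block_isometry R I = 1%:M.
Proof.
move=> hI; have [c0 _ uI] := block_familyP hI; apply/matrixP=> k l.
rewrite mxE [RHS]mxE; under eq_bigr => i _ do rewrite mxE !block_isometryE.
have [<-|kl] := eqVneq k l; last first.
  rewrite big1// => i _; case: (boolP (i \in I k)) => ik; last by rewrite !mul0r.
  case: (boolP (i \in I l)) => il; last by rewrite !mul0r mulr0.
  by rewrite (uI _ _ _ ik il) eqxx in kl.
rewrite (bigID (mem (I k))) /= [X in _ + X]big1 ?addr0; last first.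
  by move=> i /negPf ->; rewrite !mul0r.
under eq_bigr => i ik do rewrite ik !mul1r -invfM -expr2 sqrtCK.
by rewrite sumr_const -[LHS]mulr_natl mulfV// pnatr_eq0 -lt0n.
Qed.

Lemma block_isometryMT (R : realType) (N m : nat) (I : 'I_m -> {set 'I_N}) :
  block_isometry R I *m (block_isometry R I)^T = Sbar_unit R I.
Proof.
apply/matrixP=> i j; rewrite mxE summxE; apply: eq_bigr => k _.
rewrite [X in _ * X]mxE !block_isometryE !mxE mulrACA -invfM -expr2 sqrtCK.
by rewrite -natrM mulnb mulrC.
Qed.

Lemma ThetaK (R : realType) (N m : nat) (I : 'I_m -> {set 'I_N})
    (B : 'M[Cplx R]_m) : block_family I -> Theta I (Lift I B) = B.
Proof.
move=> hI; rewrite Theta_block_isometry /Lift !mulmxA block_isometryTM// mul1mx.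
by rewrite -mulmxA block_isometryTM// mulmx1.
Qed.

Lemma Lift_block_constant (R : realType) (N m : nat) (I : 'I_m -> {set 'I_N})
    (B : 'M[Cplx R]_m) : block_family I -> block_constant (blocks I) (Lift I B).
Proof.
move=> hI; have [_ _ uI] := block_familyP hI.
have rowE k i i' : i \in I k -> i' \in I k ->
    block_isometry R I i =1 block_isometry R I i'.
  move=> ik i'k l; rewrite !block_isometryE.
  have [<-|kl] := eqVneq k l; first by rewrite ik i'k.
  have nI i0 : i0 \in I k -> i0 \in I l = false.
    by move=> i0k; apply/negP => /(uI _ _ _ i0k)/eqP; rewrite (negPf kl).
  by rewrite !nI.
apply/block_constantP => k l i i' j j' ik i'k jl j'l; rewrite /Lift mxE [RHS]mxE.
apply: eq_bigr => a _; rewrite 2![_^T _ _]mxE (rowE _ _ _ jl j'l).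
congr (_ * _); rewrite mxE [RHS]mxE.
by apply: eq_bigr => b _; rewrite (rowE _ _ _ ik i'k).
Qed.

(** Multiplying by the unit averages each column over the blocks. *)
Lemma Sbar_unit_mul (R : realType) (N m : nat) (I : 'I_m -> {set 'I_N})
    (A : 'M[Cplx R]_N) : block_family I -> block_constant (blocks I) A ->
  Sbar_unit R I *m A = A.
Proof.
move=> hI /block_constantP cA; have [c0 eI uI] := block_familyP hI.
apply/matrixP=> i j; have [k ik] := eI i; have [l jl] := eI j.
rewrite mxE (bigID (mem (I k))) /= [X in _ + X]big1 ?addr0; last first.
  move=> i' i'k; rewrite summxE big1 ?mul0r// => k' _; rewrite !mxE.
  case: (boolP (i \in I k')) => ik'; last by rewrite mulr0.
  by rewrite -(uI _ _ _ ik ik') (negPf i'k) mulr0.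
rewrite (eq_bigr (fun=> (#|I k|%:R)^-1 * A i j)); last first.
  move=> i' i'k; rewrite (cA k l i' i j j)//; congr (_ * _).
  rewrite summxE (bigD1 k)//= big1 ?addr0 => [|k' kk']; rewrite !mxE.
    by rewrite ik i'k mulr1.
  case: (boolP (i \in I k')) => ik'; last by rewrite mulr0.
  by rewrite (uI _ _ _ ik ik') eqxx in kk'.
rewrite sumr_const -mulrnAl -[X in X * _ = _]mulr_natr mulVf ?mul1r//.
by rewrite pnatr_eq0 -lt0n.
Qed.

Lemma Sbar_unit_tr (R : realType) (N m : nat) (I : 'I_m -> {set 'I_N}) :
  (Sbar_unit R I)^T = Sbar_unit R I.
Proof. by rewrite -block_isometryMT trmx_mul trmxK. Qed.

Lemma mul_Sbar_unit (R : realType) (N m : nat) (I : 'I_m -> {set 'I_N})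
    (A : 'M[Cplx R]_N) : block_family I -> block_constant (blocks I) A ->
  A *m Sbar_unit R I = A.
Proof.
move=> hI /block_constantP cA; apply: trmx_inj; rewrite trmx_mul Sbar_unit_tr.
apply: Sbar_unit_mul => //; apply/block_constantP => k l i i' j j' *.
by rewrite !mxE; apply: (cA l k).
Qed.

Lemma LiftK (R : realType) (N m : nat) (I : 'I_m -> {set 'I_N})
    (A : 'M[Cplx R]_N) : block_family I -> block_constant (blocks I) A ->
  Lift I (Theta I A) = A.
Proof.
move=> hI cA; rewrite Theta_block_isometry /Lift !mulmxA block_isometryMT.
by rewrite Sbar_unit_mul// -mulmxA block_isometryMT mul_Sbar_unit.
Qed.

Lemma LiftM (R : realType) (N m : nat) (I : 'I_m -> {set 'I_N})
    (A B : 'M[Cplx R]_m) : block_family I ->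
  Lift I (A *m B) = Lift I A *m Lift I B.
Proof.
move=> hI; rewrite /Lift -{1}[A]mulmx1 -(block_isometryTM _ _ _ _ hI).
by rewrite !mulmxA.
Qed.

Lemma LiftE (R : realType) (N m : nat) (I : 'I_m -> {set 'I_N})
    (B : 'M[Cplx R]_m) i j :
  Lift I B i j = \sum_(p : 'I_m * 'I_m)
    block_isometry R I i p.1 * block_isometry R I j p.2 * B p.1 p.2.
Proof.
rewrite /Lift mxE; under eq_bigr do rewrite mxE mulr_suml.
rewrite exchange_big pair_big /=; apply: eq_bigr => p _.
by rewrite [_^T _ _]mxE mulrAC.
Qed.

Lemma LiftZ (R : realType) (N m : nat) (I : 'I_m -> {set 'I_N}) (a : Cplx R)
    (B : 'M[Cplx R]_m) : Lift I (a *: B) = a *: Lift I B.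
Proof. by rewrite /Lift -scalemxAr -scalemxAl. Qed.

Lemma Lift1 (R : realType) (N m : nat) (I : 'I_m -> {set 'I_N}) :
  Lift I 1%:M = Sbar_unit R I.
Proof. by rewrite /Lift mulmx1 block_isometryMT. Qed.

Lemma Lift_resolvent (R : realType) (N m : nat) (I : 'I_m -> {set 'I_N})
    (B : 'M[Cplx R]_m) z :
  Lift I (z%:M - B) = z *: Sbar_unit R I - Lift I B.
Proof.
rewrite -Lift1 /Lift mulmxBr mulmxBl mul_mx_scalar mulmx1.
by rewrite -scalemxAl.
Qed.

(** * The closure of the matrices with a prescribed coarsest partition *)

(** Arbitrarily small positive numbers, of the form [e / n], outside a finite
    set. *)
Lemma ratio_seq_avoids (C : numFieldType) (e : C) (s : seq C) (d : nat) :
  0 < e -> exists n : nat, e / (n + d).+1%:R \notin s.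
Proof.
move=> e0; apply: contrapT => /forallNP sn.
pose f n : C := e / (n + d).+1%:R.
have : (size (map f (iota 0 (size s).+1)) <= size s)%N.
  apply: uniq_leq_size => [|_ /mapP[n _ ->]]; last exact/negPn/negP/sn.
  rewrite map_inj_uniq ?iota_uniq// => a b /(mulfI (lt0r_neq0 e0))/invr_inj/eqP.
  by rewrite eqr_nat eqSS eqn_add2r => /eqP.
by rewrite size_map size_iota ltnn.
Qed.

Lemma cvg_affine0 (C : numFieldType) (a b : C) :
  (a + t * b) @[t --> (0 : C)] --> a.
Proof.
have FF : Filter (nbhs (0 : C)) by exact: nbhs_filter.
suff : (a + t * b) @[t --> (0 : C)] --> a + 0 * b by rewrite mul0r addr0.
apply: cvgD; first exact: cvg_cst.
by apply: cvgM; [exact: cvg_id|exact: cvg_cst].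
Qed.

(** If two entries in the same block differed, a matrix of the set within half
    their distance would contradict the triangle inequality. *)
Lemma closure_S_part_block_constant (C : numFieldType) (N m : nat)
    (I : 'I_m -> {set 'I_N}) (A : 'M[C]_N) :
  closure (@S_part C N (blocks I)) A -> block_constant (blocks I) A.
Proof.
move=> clA; apply/block_constantP => k l i i' j j' ik i'k jl j'l.
apply/eqP; apply/negPn/negP => neq.
pose d := `|A i j - A i' j'| / 2.
have d0 : 0 < d by rewrite divr_gt0 ?normr_gt0 ?subr_eq0.
have [M [[/block_constantP cM _] /= near_M]] : @S_part C N (blocks I)
    `&` [set M | forall a b, ball (A a b) d (M a b)] !=set0.
  apply: clA; exists (fun a b => ball (A a b) d) => // a b.
  exact: nbhsx_ballx.
have := ler_distD (M i j) (A i j) (A i' j').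
rewrite {2}(cM k l i i' j j')// => /le_lt_trans => /(_ (d + d)).
have -> : d + d = `|A i j - A i' j'| by rewrite /d -splitr.
rewrite ltxx => H; apply: (notF (H _)); rewrite [ltRHS]splitr.
apply: ltrD; first exact: near_M.
by rewrite distrC; exact: near_M.
Qed.

(** Adding [t] times the number of the block to each row separates the diagonal
    values of distinct blocks for all but finitely many [t].  A set on which the
    perturbed matrix is constant then lies in one block, since the diagonal
    entries indexed by it coincide. *)
Lemma block_constant_closure_S_part (C : numFieldType) (N m : nat)
    (I : 'I_m -> {set 'I_N}) (A : 'M[C]_N) : block_family I ->
  block_constant (blocks I) A -> closure (@S_part C N (blocks I)) A.
Proof.
move=> hI /block_constantP cA B [P PA PB]; have [c0 eI uI] := block_familyP hI.
have [b bI] := choice eI.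
have bE i k : i \in I k -> b i = k by exact: uI.
pose M (t : C) : 'M[C]_N := \matrix_(i, j) (A i j + t * (b i)%:R).
have [e e0 eP] : exists2 e : C, 0 < e &
    forall t, ball 0 e t -> forall i j, P i j (M t i j).
  have : \forall t \near (0 : C), forall ij : 'I_N * 'I_N,
      P ij.1 ij.2 (M t ij.1 ij.2).
    have := @filter_forall _ _ (fun (ij : 'I_N * 'I_N) t =>
      P ij.1 ij.2 (M t ij.1 ij.2)) (nbhs (0 : C)) _; apply => -[i j] /=.
    have := cvg_affine0 C (A i j) (b i)%:R => /(_ _ (PA i j)).
    by apply: (@filterS _ (nbhs (0 : C)) _) => t; rewrite mxE.
  move=> /nbhs_ballP[e e0 eP]; exists e => // t te i j.
  exact: (eP t te (i, j)).
(* The values of [t] for which two diagonal entries may collide. *)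
pose s := [seq (A p.2 p.2 - A p.1 p.1) / ((b p.1)%:R - (b p.2)%:R)
           | p : 'I_N * 'I_N].
have [n sn] := ratio_seq_avoids C e s 1 e0.
set t := e / _ in sn.
exists (M t); split; last first.
  apply: PB; apply: eP; rewrite -ball_normE /= sub0r normrN gtr0_norm.
    by rewrite ltr_pdivrMr ?ltr0Sn// ltr_pMr// ltr1n addn1.
  by rewrite divr_gt0// ltr0Sn.
split.
  apply/block_constantP => k l i i' j j' ik i'k jl j'l; rewrite !mxE.
  by rewrite (cA k l i i' j j')// (bE _ _ ik) (bE _ _ i'k).
move=> Q /and3P[_ _ Q0] cM J JQ.
have [J0|[i iJ]] := set_0Vmem J; first by rewrite -J0 JQ in Q0.
exists (I (b i)); first by apply: imset_f; rewrite inE.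
apply/fintype.subsetP => i' i'J.
have [->|bii'] := eqVneq (b i) (b i'); first exact: bI.
have := cM _ _ JQ JQ _ _ _ _ iJ i'J iJ i'J; rewrite !mxE => ME.
have bb : (b i)%:R - (b i')%:R != 0 :> C by rewrite subr_eq0 eqr_nat.
have tE : t * ((b i)%:R - (b i')%:R) = A i' i' - A i i.
  by apply/eqP; rewrite mulrBr subr_eq addrAC -ME [_ + t * _]addrC addrK.
case/negP: sn; apply/mapP; exists (i, i'); rewrite ?mem_enum//=.
by rewrite -tE mulfK.
Qed.

Lemma SbarE (R : realType) (N m : nat) (I : 'I_m -> {set 'I_N}) A :
  block_family I -> Sbar R I A <-> block_constant (blocks I) A.
Proof.
move=> hI; split; first exact: closure_S_part_block_constant.
exact: block_constant_closure_S_part.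
Qed.

(** * Spectra and resolvents *)

Lemma mx_spectrumE (C : fieldType) (n : nat) (B : 'M[C]_n) (z : C) :
  mx_spectrum B z <-> z%:M - B \notin unitmx.
Proof.
rewrite /mx_spectrum /= /eigenvalue /eigenspace kermx_eq0 -opprB row_free_unit.
by rewrite -[- _]scaleN1r unitmxZ ?unitrN1.
Qed.

Lemma alg_spectrum_setT (C : fieldType) (n : nat) (B : 'M[C]_n) :
  alg_spectrum [set: 'M[C]_n] 1%:M B = mx_spectrum B.
Proof.
apply/seteqP; split=> z; rewrite mx_spectrumE /alg_spectrum /= scalemx1.
  move=> nz; apply/negP => u; apply: nz; exists (invmx (z%:M - B)).
  by split; rewrite ?mulmxV ?mulVmx.
by move=> /negP nu [y [_ zy _]]; apply: nu; have [] := mulmx1_unit zy.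
Qed.

(** Invertibility transfers along [Lift], which maps the identity matrix to the
    unit of the algebra. *)
Lemma alg_inverse_Lift (R : realType) (N m : nat) (I : 'I_m -> {set 'I_N})
    (B : 'M[Cplx R]_m) (Y : 'M[Cplx R]_N) : block_family I ->
  alg_inverse (Sbar R I) (Sbar_unit R I) (Lift I B) Y <->
  B \in unitmx /\ Y = Lift I (invmx B).
Proof.
move=> hI; split=> [[/SbarE-/(_ hI) cY BY _]|[uB ->]].
  have By : B *m Theta I Y = 1%:M.
    rewrite -[LHS](ThetaK _ _ _ I)// LiftM// LiftK// BY -Lift1.
    by rewrite ThetaK.
  have [uB _] := mulmx1_unit By.
  by split=> //; rewrite -[invmx B]mulmx1 -By mulKmx// LiftK.
split; first by apply/SbarE => //; exact: Lift_block_constant.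
  by rewrite -LiftM// mulmxV// Lift1.
by rewrite -LiftM// mulVmx// Lift1.
Qed.

Lemma alg_spectrum_Sbar (R : realType) (N m : nat) (I : 'I_m -> {set 'I_N})
    (A : 'M[Cplx R]_N) : block_family I -> Sbar R I A ->
  alg_spectrum (Sbar R I) (Sbar_unit R I) A = mx_spectrum (Theta I A).
Proof.
move=> hI /SbarE-/(_ hI) cA; apply/seteqP; split=> z; rewrite mx_spectrumE.
  move=> nz; apply/negP => u; apply: nz.
  exists (Lift I (invmx (z%:M - Theta I A))).
  by rewrite -{1}(LiftK _ _ _ I A)// -Lift_resolvent; apply/alg_inverse_Lift.
move=> /negP nu [Y]; rewrite -{1}(LiftK _ _ _ I A)// -Lift_resolvent.
by move=> /alg_inverse_Lift-/(_ hI)[].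
Qed.

Lemma alg_resolvent_Sbar (R : realType) (N m : nat) (I : 'I_m -> {set 'I_N})
    (A : 'M[Cplx R]_N) (z : Cplx R) : block_family I -> Sbar R I A ->
  ~ mx_spectrum (Theta I A) z ->
  alg_resolvent (Sbar R I) (Sbar_unit R I) A z
    = Lift I (mx_resolvent (Theta I A) z).
Proof.
move=> hI /SbarE-/(_ hI) cA /mx_spectrumE/negP/negPn u.
rewrite /alg_resolvent -{1}(LiftK _ _ _ I A)// -Lift_resolvent.
apply: xget_unique; first by apply/alg_inverse_Lift.
by move=> Y /alg_inverse_Lift-/(_ hI)[].
Qed.

(** The spectrum is the root set of the characteristic polynomial, which splits
    over a closed field. *)
Lemma mx_spectrum_seq (C : closedFieldType) (n : nat) (B : 'M[C]_n) :
  exists s : seq C, uniq s /\ mx_spectrum B = [set` s].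
Proof.
have [s sE] := closed_field_poly_normal (char_poly B).
exists (undup s); rewrite undup_uniq; split=> //; apply/seteqP.
have rootE z : mx_spectrum B z <-> z \in undup s.
  rewrite mem_undup /mx_spectrum /= eigenvalue_root_char sE.
  by rewrite (monicP (char_poly_monic B)) scale1r root_prod_XsubC.
by split=> z /= /rootE.
Qed.

(** * Continuity in the complex plane *)

(** Positive complex numbers are real, so neighbourhoods may be tested with real
    radii. *)
Lemma real_complex_nbhsP (R : realType) (z : Cplx R) (P : set (Cplx R)) :
  nbhs z P <-> exists2 e : R, 0 < e & forall w, `|z - w| < Complex e 0 -> P w.
Proof.
split=> [/nbhs_ballP[e e0 eP]|[e e0 eP]].
  have eE : e = Complex (complex.Re e) 0.
    by move: e0; rewrite /= ltcE => /andP[/eqP ei _]; case: e ei {eP} => a b /= ->.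
  exists (complex.Re e) => [|w zw]; first by move: e0; rewrite /= ltcE => /andP[].
  by apply: eP; rewrite -ball_normE /= eE.
apply/nbhs_ballP; exists (Complex e 0 : Cplx R); first by rewrite /= ltcR.
by move=> w; rewrite -ball_normE => /eP.
Qed.

Lemma le_norm_Re (R : realType) (z : Cplx R) :
  Complex `|complex.Re z| 0 <= `|z|.
Proof. exact: normc_ge_Re. Qed.

Lemma le_norm_Im (R : realType) (z : Cplx R) :
  Complex `|complex.Im z| 0 <= `|z|.
Proof.
rewrite normc_def lecR -sqrtr_sqr ler_wsqrtr// lerDr sqr_ge0//.
Qed.

Lemma continuous_Re (R : realType) (z : Cplx R) :
  {for z, continuous (fun w : Cplx R => complex.Re w : R)}.
Proof.
move=> P /nbhs_ballP[e e0 eP]; apply/real_complex_nbhsP; exists e => // w zw.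
apply: eP; rewrite -ball_normE /= -ltcR -raddfB.
exact: le_lt_trans (le_norm_Re _ _) zw.
Qed.

Lemma continuous_Im (R : realType) (z : Cplx R) :
  {for z, continuous (fun w : Cplx R => complex.Im w : R)}.
Proof.
move=> P /nbhs_ballP[e e0 eP]; apply/real_complex_nbhsP; exists e => // w zw.
apply: eP; rewrite -ball_normE /= -ltcR -raddfB.
exact: le_lt_trans (le_norm_Im _ _) zw.
Qed.

Lemma continuous_Complex (R : realType) (a b : R -> R) (t : R) :
  {for t, continuous a} -> {for t, continuous b} ->
  {for t, continuous (fun s => Complex (a s) (b s) : Cplx R)}.
Proof.
move=> ca cb P /real_complex_nbhsP[e e0 eP].
have e2 : 0 < e / 2 by rewrite divr_gt0.
have FF : Filter (nbhs t) by exact: nbhs_filter.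
have /(_ FF) A := cvgr_dist_lt _ _ ca _ e2.
have /(_ FF) B := cvgr_dist_lt _ _ cb _ e2.
suff : \forall s \near t, P (Complex (a s) (b s)) by [].
near=> s; apply: eP.
have as_ : `|a t - a s| < e / 2 by near: s.
have bs_ : `|b t - b s| < e / 2 by near: s.
rewrite normc_def /= ltcR -[ltRHS]gtr0_norm// -sqrtr_sqr.
rewrite ltr_sqrt ?exprn_gt0//.
have sq x : `|x| < e / 2 -> x ^+ 2 < (e / 2) ^+ 2.
  by move=> xe; rewrite -real_normK ?num_real// ltrXn2r// ?nnegrE// ltW.
apply: lt_trans (ltrD (sq _ as_) (sq _ bs_)) _.
rewrite [in ltRHS](splitr e); set h := e / 2 in e2 *; nra.
Unshelve. all: by end_near. Qed.

Lemma cvg_det (C : numFieldType) (T : Type) (F : set_system T) (n : nat)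
    (M : T -> 'M[C]_n) (L : 'M[C]_n) : Filter F ->
  (forall i j, M x i j @[x --> F] --> L i j) ->
  \det (M x) @[x --> F] --> \det L.
Proof.
move=> FF ML; rewrite /determinant.
apply: cvg_big => [|s _]; first exact: add_continuous.
apply: cvgM; first exact: cvg_cst.
by apply: cvg_big => [|i _]; [exact: mul_continuous|exact: ML].
Qed.

(** By Cramer's rule the entries of the inverse are quotients of determinants,
    near any point where the determinant is nonzero. *)
Lemma cvg_invmx (C : numFieldType) (T : Type) (F : set_system T) (n : nat)
    (M : T -> 'M[C]_n) (L : 'M[C]_n) : Filter F ->
  (forall i j, M x i j @[x --> F] --> L i j) -> L \in unitmx ->
  forall i j, invmx (M x) i j @[x --> F] --> invmx L i j.
Proof.
move=> FF ML uL i j.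
have detL : \det L != 0 by rewrite -unitfE -unitmxE.
have cdet := cvg_det _ _ _ _ _ _ FF ML.
have invE (A : 'M[C]_n) : \det A != 0 ->
    invmx A i j = (\det A)^-1 * ((-1) ^+ (j + i) * \det (row' j (col' i A))).
  by move=> dA; rewrite /invmx unitmxE unitfE dA !mxE.
have near_inv : \forall x \near F, (\det (M x))^-1 *
    ((-1) ^+ (j + i) * \det (row' j (col' i (M x)))) = invmx (M x) i j.
  near=> x; apply/esym/invE; near: x.
  exact: cvgr_neq0 cdet detL.
rewrite invE//; apply: cvg_trans (near_eq_cvg near_inv) _.
apply: cvgM; first exact: cvgV.
apply: cvgM; first exact: cvg_cst.
by apply: cvg_det => k l; rewrite !mxE; under eq_fun do rewrite !mxE; exact: ML.
Unshelve. all: by end_near. Qed.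

Lemma cvg_mx_resolvent (C : numFieldType) (T : Type) (F : set_system T)
    (n : nat) (B : 'M[C]_n) (g : T -> C) (z : C) : Filter F ->
  g x @[x --> F] --> z -> ~ mx_spectrum B z ->
  forall i j, mx_resolvent B (g x) i j @[x --> F] --> mx_resolvent B z i j.
Proof.
move=> FF gz /mx_spectrumE/negP/negPn uz; apply: cvg_invmx => // i j.
rewrite !mxE; under eq_fun do rewrite !mxE.
apply: cvgB; last exact: cvg_cst.
have [_|_] := eqVneq i j; rewrite ?mulr1n ?mulr0n; first exact: gz.
exact: cvg_cst.
Qed.

Lemma derivable_continuous1 (C : numFieldType) (f : C^o -> C^o) (z : C) :
  derivable f z 1 -> f w @[w --> z] --> f z.
Proof. by move=> /derivable1_diffP/differentiable_continuous. Qed.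

(** * Linearity of the contour integral *)

Definition integrable01 (R : realType) (F : R -> Cplx R) : Prop :=
  (@lebesgue_measure R).-integrable `[0, 1] (EFin \o (fun t => complex.Re (F t)))
  /\
  (@lebesgue_measure R).-integrable `[0, 1] (EFin \o (fun t => complex.Im (F t))).

Lemma continuous_integrable01 (R : realType) (F : R -> Cplx R) :
  (forall t, 0 <= t <= 1 -> {for t, continuous F}) -> integrable01 R F.
Proof.
move=> cF; split; apply: continuous_compact_integrable;
    try exact: segment_compact;
  apply: continuous_in_subspaceT => t; rewrite inE /= in_itv => /cF cFt.
- exact: (continuous_comp cFt (@continuous_Re R (F t))).
- exact: (continuous_comp cFt (@continuous_Im R (F t))).
Qed.

Lemma eq_integral01 (R : realType) (F G : R -> Cplx R) :
  (forall t, 0 <= t <= 1 -> F t = G t) -> integral01 F = integral01 G.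
Proof.
move=> FG; rewrite /integral01; congr Complex;
  by apply: eq_Rintegral => t; rewrite inE /= in_itv => /FG ->.
Qed.

Lemma integral01D (R : realType) (F G : R -> Cplx R) :
  integrable01 R F -> integrable01 R G ->
  integral01 (fun t => F t + G t) = integral01 F + integral01 G.
Proof.
move=> [iF jF] [iG jG]; rewrite /integral01.
apply/eqP; rewrite eq_complex /= -!RintegralD//; apply/andP; split.
  by apply/eqP/eq_Rintegral => t _; rewrite raddfD.
by apply/eqP/eq_Rintegral => t _; rewrite raddfD.
Qed.

Lemma integrable01Z (R : realType) (c : Cplx R) (F : R -> Cplx R) :
  integrable01 R F -> integrable01 R (fun t => c * F t).
Proof.
case: c => a b [iF jF]; split.
  rewrite (_ : _ \o _ = (fun t => a%:E * (complex.Re (F t))%:E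
      + (- b)%:E * (complex.Im (F t))%:E)%E).
    by apply: integrableD => //; exact: integrableZl.
  apply/funext => t /=; case: (F t) => u v /=.
  by rewrite -!EFinM -EFinD mulNr.
rewrite (_ : _ \o _ = (fun t => a%:E * (complex.Im (F t))%:E
    + b%:E * (complex.Re (F t))%:E)%E).
  by apply: integrableD => //; exact: integrableZl.
by apply/funext => t /=; case: (F t) => u v /=; rewrite -!EFinM -EFinD.
Qed.

Lemma integrable01D (R : realType) (F G : R -> Cplx R) :
  integrable01 R F -> integrable01 R G -> integrable01 R (fun t => F t + G t).
Proof.
move=> [iF jF] [iG jG]; split.
  rewrite (_ : _ \o _ = (fun t => (complex.Re (F t))%:E
      + (complex.Re (G t))%:E)%E); first exact: integrableD.
  by apply/funext => t /=; rewrite raddfD.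
rewrite (_ : _ \o _ = (fun t => (complex.Im (F t))%:E
    + (complex.Im (G t))%:E)%E); first exact: integrableD.
by apply/funext => t /=; rewrite raddfD.
Qed.

Lemma integral01Z (R : realType) (c : Cplx R) (F : R -> Cplx R) :
  integrable01 R F -> integral01 (fun t => c * F t) = c * integral01 F.
Proof.
case: c => a b [iF jF]; rewrite /integral01.
have iZ (r : R) (f : R -> R) :
    (@lebesgue_measure R).-integrable `[0, 1] (EFin \o f) ->
    (@lebesgue_measure R).-integrable `[0, 1] (EFin \o (fun t => r * f t)).
  by move=> fi; have := integrableZl _ r fi; exact.
apply/eqP; rewrite eq_complex /= -!RintegralZl//; apply/andP; split.
  rewrite -RintegralB//; [|exact: iZ..].
  by apply/eqP/eq_Rintegral => t _; case: (F t).
rewrite -RintegralD//; [|exact: iZ..].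
by apply/eqP/eq_Rintegral => t _; case: (F t).
Qed.

Lemma integral01_0 (R : realType) : integral01 (fun=> 0 : Cplx R) = 0.
Proof.
rewrite /integral01 /=; apply/eqP; rewrite eq_complex /=.
by rewrite Rintegral_cst//= mul0r eqxx.
Qed.

Lemma integrable01_0 (R : realType) : integrable01 R (fun=> 0).
Proof. by apply: continuous_integrable01 => t _; exact: cst_continuous. Qed.

Lemma integrable01_lin (R : realType) (T : Type) (s : seq T)
    (c : T -> Cplx R) (F : T -> R -> Cplx R) :
  (forall p, integrable01 R (F p)) ->
  integrable01 R (fun t => \sum_(p <- s) c p * F p t).
Proof.
move=> iF; elim: s => [|p s IHs].
  under eq_fun do rewrite big_nil; exact: integrable01_0.
under eq_fun do rewrite big_cons.
by apply: integrable01D => //; exact: integrable01Z.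
Qed.

Lemma integral01_lin (R : realType) (T : Type) (s : seq T)
    (c : T -> Cplx R) (F : T -> R -> Cplx R) :
  (forall p, integrable01 R (F p)) ->
  integral01 (fun t => \sum_(p <- s) c p * F p t)
    = \sum_(p <- s) c p * integral01 (F p).
Proof.
move=> iF; elim: s => [|p s IHs].
  rewrite big_nil -[RHS](integral01_0 R); congr integral01.
  by apply/funext => t; rewrite big_nil.
rewrite big_cons -IHs -integral01Z// -integral01D.
- by congr integral01; apply/funext => t; rewrite big_cons.
- exact: integrable01Z.
- exact: integrable01_lin.
Qed.

(** Arcs are functions, whose type has no decidable equality, so membership in
    a contour is the propositional one. *)
Lemma eq_big_In (C : nmodType) (T : Type) (s : seq T) (F G : T -> C) :
  (forall x, List.In x s -> F x = G x) ->
  \sum_(x <- s) F x = \sum_(x <- s) G x.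
Proof.
elim: s => [|x s IHs] FG; first by rewrite !big_nil.
rewrite !big_cons FG; last by left.
by rewrite IHs// => y ys; apply: FG; right.
Qed.

(** The relations are required on the arcs only: the resolvent identities fail
    on the spectrum. *)
Lemma contour_integral_lin (R : realType) (T : Type) (s : seq T)
    (G : contour R) (c : T -> Cplx R) (h : Cplx R -> Cplx R)
    (k : T -> Cplx R -> Cplx R) :
  all_arcs G (fun g => (forall t, 0 <= t <= 1 ->
      h (g t) = \sum_(p <- s) c p * k p (g t)) /\
    (forall p, integrable01 R (fun t => k p (g t) * deriv_path g t))) ->
  contour_integral G h = \sum_(p <- s) c p * contour_integral G (k p).
Proof.
move=> hG; rewrite /contour_integral.
under [RHS]eq_bigr do rewrite mulr_sumr.
rewrite [RHS]exchange_big /=; apply: eq_big_In => loop loopG.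
under [RHS]eq_bigr do rewrite mulr_sumr.
rewrite [RHS]exchange_big /=; apply: eq_big_In => g gloop.
have [hE ik] := hG _ loopG _ gloop.
rewrite -integral01_lin//; apply: eq_integral01 => t /hE ->.
by rewrite mulr_suml; apply: eq_bigr => p _; rewrite mulrA.
Qed.

(** * Winding numbers of circles *)

Definition circle (R : realType) (c : Cplx R) (r t : R) : Cplx R :=
  Complex (complex.Re c + r * cos (2 * pi * t))
          (complex.Im c + r * sin (2 * pi * t)).

Lemma is_derive_cos2pi (R : realType) (a r t : R) :
  is_derive t (1 : R) (fun s => a + r * cos (2 * pi * s))
    (- (2 * pi * (r * sin (2 * pi * t)))).
Proof.
have d2 : is_derive t (1 : R) (fun s : R => 2 * pi * s) (2 * pi).
  by apply: is_derive_eq; rewrite scaler1.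
have dc := is_derive1_comp (is_derive_cos (2 * pi * t)) d2.
apply: (is_derive_eq (is_deriveD (is_derive_cst a t 1) (is_deriveZ r dc))).
by rewrite add0r /GRing.scale /=; ring.
Qed.

Lemma is_derive_sin2pi (R : realType) (a r t : R) :
  is_derive t (1 : R) (fun s => a + r * sin (2 * pi * s))
    (2 * pi * (r * cos (2 * pi * t))).
Proof.
have d2 : is_derive t (1 : R) (fun s : R => 2 * pi * s) (2 * pi).
  by apply: is_derive_eq; rewrite scaler1.
have dc := is_derive1_comp (is_derive_sin (2 * pi * t)) d2.
apply: (is_derive_eq (is_deriveD (is_derive_cst a t 1) (is_deriveZ r dc))).
by rewrite add0r /GRing.scale /=; ring.
Qed.

Lemma is_derive_continuous (R : realType) (f : R -> R) (t d : R) :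
  is_derive t (1 : R) f d -> {for t, continuous f}.
Proof.
by move=> [df _]; apply/differentiable_continuous/derivable1_diffP.
Qed.

Lemma deriv_path_circle (R : realType) (c : Cplx R) (r t : R) :
  deriv_path (circle R c r) t
    = Complex (- (2 * pi * (r * sin (2 * pi * t))))
              (2 * pi * (r * cos (2 * pi * t))).
Proof.
rewrite /deriv_path !derive1E; congr Complex.
  exact: (derive_val (is_derive := is_derive_cos2pi R (complex.Re c) r t)).
exact: (derive_val (is_derive := is_derive_sin2pi R (complex.Im c) r t)).
Qed.

Lemma circle_C1 (R : realType) (c : Cplx R) (r : R) : C1_path (circle R c r).
Proof.
split=> t.
- exact: (ex_derive (is_derive := is_derive_cos2pi R (complex.Re c) r t)).
- exact: (ex_derive (is_derive := is_derive_sin2pi R (complex.Im c) r t)).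
- have -> : derive1 (fun s => complex.Re (circle R c r s))
      = fun s => 0 + (- (2 * pi * r)) * sin (2 * pi * s).
    apply/funext => s; have [] := deriv_path_circle R c r s => -> _.
    by rewrite add0r mulNr !mulrA.
  exact: is_derive_continuous (is_derive_sin2pi _ _ _ _).
- have -> : derive1 (fun s => complex.Im (circle R c r s))
      = fun s => 0 + (2 * pi * r) * cos (2 * pi * s).
    apply/funext => s; have [] := deriv_path_circle R c r s => _ ->.
    by rewrite add0r !mulrA.
  exact: is_derive_continuous (is_derive_cos2pi _ _ _ _).
Qed.

Lemma circle_closed (R : realType) (c : Cplx R) (r : R) :
  circle R c r 1 = circle R c r 0.
Proof. by rewrite /circle mulr1 mulr0 mulr_natl cos2pi sin2pi cos0 sin0. Qed.

Lemma norm_circle (R : realType) (c : Cplx R) (r t : R) : 0 <= r ->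
  `|c - circle R c r t| = Complex r 0.
Proof.
move=> r0; rewrite normc_def; congr (real_complex R _).
case: c => a b /=; rewrite !opprD !addNKr !sqrrN !exprMn -mulrDr cos2Dsin2.
by rewrite mulr1 sqrtr_sqr ger0_norm.
Qed.

Lemma Rintegral_derivative_loop (R : realType) (F f : R -> R) :
  (forall t, is_derive t (1 : R) F (f t)) -> continuous f -> F 0 = F 1 ->
  \int[@lebesgue_measure R]_(t in `[0, 1]) f t = 0.
Proof.
move=> dF cf F01; rewrite /Rintegral (@continuous_FTC2 R f F 0 1)//=.
- by rewrite F01 subrr.
- exact: continuous_subspaceT.
- have cF t : {for t, continuous F} by exact: is_derive_continuous (dF t).
  split=> [t _||]; first exact: ex_derive.
    exact: cvg_at_right_filter (cF 0).
  exact: cvg_at_left_filter (cF 1).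
- by move=> t _; rewrite derive1E derive_val.
Qed.

(** A loop [p + i q] in the right half-plane has the logarithm
    [ln (p^2 + q^2) / 2 + i atan (q / p)], which returns to its initial value, so
    its logarithmic derivative has integral 0. *)
Lemma integral01_dlog_loop (R : realType) (p q p' q' : R -> R) :
  (forall t, is_derive t (1 : R) p (p' t)) ->
  (forall t, is_derive t (1 : R) q (q' t)) ->
  continuous p' -> continuous q' -> (forall t, 0 < p t) ->
  p 0 = p 1 -> q 0 = q 1 ->
  integral01 (fun t => (Complex (p t) (q t) : Cplx R)^-1 * Complex (p' t) (q' t))
    = 0.
Proof.
move=> dp dq cp' cq' p0 p01 q01.
have cp t : {for t, continuous p} := is_derive_continuous _ _ _ _ (dp t).
have cq t : {for t, continuous q} := is_derive_continuous _ _ _ _ (dq t).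
pose n t := p t * p t + q t * q t.
have n0 t : 0 < n t by rewrite ltr_wpDr -?expr2 ?sqr_ge0// exprn_gt0.
have E t : (Complex (p t) (q t) : Cplx R)^-1 * Complex (p' t) (q' t)
    = Complex ((n t)^-1 * (p t * p' t + q t * q' t))
              ((n t)^-1 * (p t * q' t - q t * p' t)).
  apply/eqP; rewrite eq_complex /= /n; apply/andP; split; apply/eqP;
    by field; exact: lt0r_neq0 (n0 t).
have cn : continuous (fun t => (n t)^-1).
  move=> t; apply: (cvgV (lt0r_neq0 (n0 t))).
  by apply: cvgD; apply: cvgM; (exact: cp || exact: cq).
have mul_cont (a b : R -> R) : continuous a -> continuous b ->
    continuous (fun t => a t * b t).
  by move=> ca cb t; exact: (cvgM (ca t) (cb t)).
rewrite /integral01 -[RHS]/(Complex 0 0); congr Complex.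
  under eq_Rintegral do rewrite E /=.
  apply: (@Rintegral_derivative_loop R (fun t => 2^-1 * ln (n t))).
  - move=> t.
    have dn := is_deriveD (is_deriveM (dp t) (dp t)) (is_deriveM (dq t) (dq t)).
    have := is_deriveZ (2^-1) (is_derive1_comp (is_derive1_ln (n0 t)) dn).
    move=> /is_derive_eq; apply; rewrite /GRing.scale /=.
    by field; exact: lt0r_neq0 (n0 t).
  - apply: (mul_cont) => // t.
    by apply: cvgD; [exact: mul_cont cp cp' t|exact: mul_cont cq cq' t].
  - by rewrite /n p01 q01.
under eq_Rintegral do rewrite E /=.
apply: (@Rintegral_derivative_loop R (fun t => atan (q t / p t))).
- move=> t.
  have dV := is_deriveV (lt0r_neq0 (p0 t)) (dp t).
  have dqp : is_derive t (1 : R) (fun s => q s / p s) _ := is_deriveM (dq t) dV.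
  have := @is_derive1_comp R atan (fun s => q s / p s) t _ _
    (is_derive1_atan _) dqp.
  move=> /is_derive_eq; apply; rewrite /GRing.scale /n /=.
  by field; rewrite (lt0r_neq0 (n0 t)) (lt0r_neq0 (p0 t)).
- apply: (mul_cont) => // t.
  by apply: cvgB; [exact: mul_cont cp cq' t|exact: mul_cont cq cp' t].
- by rewrite p01 q01.
Qed.

(** Passage from the modulus in the complex numbers to an inequality between
    reals. *)
Lemma norm_sqr_mul_lt1 (R : realType) (r x y : R) : 0 < r ->
  Complex r 0 * `|Complex x y : Cplx R| < 1 -> r ^+ 2 * (x ^+ 2 + y ^+ 2) < 1.
Proof.
move=> r0; rewrite normc_def /= -[Complex r 0]/(real_complex R r) -rmorphM.
rewrite -[1]/(real_complex R 1) ltcR => rk.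
have s0 := sqrtr_ge0 (x ^+ 2 + y ^+ 2).
rewrite -[X in _ * X]sqr_sqrtr ?addr_ge0 ?sqr_ge0// -exprMn.
by rewrite expr_lt1// mulr_ge0// ltW.
Qed.

(** Dividing [z - w] by [c - w] moves the circle into the disc of centre 1 and
    radius [r / |c - w| < 1], inside the right half-plane, where
    [integral01_dlog_loop] applies. *)
Lemma integral01_circle_outside (R : realType) (c w : Cplx R) (r : R) :
  0 < r -> Complex r 0 < `|c - w| ->
  integral01 (fun t => (circle R c r t - w)^-1 * deriv_path (circle R c r) t)
    = 0.
Proof.
move=> r0 rcw; pose d : Cplx R := c - w.
have d0 : d != 0.
  by rewrite -normr_gt0; apply: le_lt_trans rcw; rewrite ler0c ltW.
case kE : (d^-1) => [x y].
have xy1 : r ^+ 2 * (x ^+ 2 + y ^+ 2) < 1.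
  apply: norm_sqr_mul_lt1 => //; rewrite -kE normrV ?unitfE//.
  by rewrite ltr_pdivrMr ?normr_gt0// mul1r.
pose C t : R := cos (2 * pi * t); pose S t : R := sin (2 * pi * t).
(* Real and imaginary parts of [(circle t - w) / (c - w)], where
   [(c - w)^-1 = x + i y], written as sums of the forms whose derivatives are
   known; [p'] and [q'] are their derivatives. *)
pose p t := (1 + (r * x) * C t) + (0 + (- (r * y)) * S t).
pose q t := (0 + (r * x) * S t) + (0 + (r * y) * C t).
pose p' t := - (2 * pi * ((r * x) * S t)) + 2 * pi * ((- (r * y)) * C t).
pose q' t := 2 * pi * ((r * x) * C t) + - (2 * pi * ((r * y) * S t)).
have C2S2 t : C t ^+ 2 + S t ^+ 2 = 1 by exact: cos2Dsin2.
rewrite -[RHS](@integral01_dlog_loop R p q p' q').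
- apply: eq_integral01 => t _; rewrite deriv_path_circle.
  have -> : circle R c r t - w = d * Complex (p t) (q t).
    have -> : Complex (p t) (q t) = 1 + d^-1 * Complex (r * C t) (r * S t).
      rewrite kE; apply/eqP; rewrite eq_complex /= /p /q.
      by apply/andP; split; apply/eqP; ring.
    rewrite mulrDr mulr1 mulVKf// /d addrAC; congr (_ - _).
    by case: c {rcw d d0 kE} => a b.
  have -> : Complex (- (2 * pi * (r * sin (2 * pi * t))))
      (2 * pi * (r * cos (2 * pi * t))) = d * Complex (p' t) (q' t).
    rewrite -[LHS](mulVKf d0) kE; congr (d * _).
    apply/eqP; rewrite eq_complex /= /p' /q' /C /S.
    by apply/andP; split; apply/eqP; ring.
  by rewrite invfM mulrACA mulVf// mul1r.
- by move=> t; exact: is_deriveD (is_derive_cos2pi _ _ _ _)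
    (is_derive_sin2pi _ _ _ _).
- by move=> t; exact: is_deriveD (is_derive_sin2pi _ _ _ _)
    (is_derive_cos2pi _ _ _ _).
- have -> : p' = fun t => (0 + (- (2 * pi * (r * x))) * S t)
      + (0 + (- (2 * pi * (r * y))) * C t).
    by apply/funext => t; rewrite /p'; ring.
  move=> t; apply: cvgD.
    exact: is_derive_continuous (is_derive_sin2pi _ _ _ t).
  exact: is_derive_continuous (is_derive_cos2pi _ _ _ t).
- have -> : q' = fun t => (0 + (2 * pi * (r * x)) * C t)
      + (0 + (- (2 * pi * (r * y))) * S t).
    by apply/funext => t; rewrite /q'; ring.
  move=> t; apply: cvgD.
    exact: is_derive_continuous (is_derive_cos2pi _ _ _ t).
  exact: is_derive_continuous (is_derive_sin2pi _ _ _ t).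
- move=> t; have := C2S2 t; rewrite /p; set a := C t; set b := S t => ab.
  (* Lagrange's identity. *)
  have L : (r * (x * a - y * b)) ^+ 2 <= r ^+ 2 * (x ^+ 2 + y ^+ 2).
    rewrite -[leRHS]mulr1 -ab -subr_ge0.
    rewrite (_ : _ - _ = (r * (x * b + y * a)) ^+ 2) ?sqr_ge0//; ring.
  have := le_lt_trans L xy1; set u := r * _ => u1.
  rewrite (_ : _ + _ = 1 + u); last by rewrite /u; ring.
  nra.
- by rewrite /p /C /S !mulr1 !mulr0 mulr_natl cos2pi sin2pi cos0 sin0.
- by rewrite /q /C /S !mulr1 !mulr0 mulr_natl cos2pi sin2pi cos0 sin0.
Qed.

(** The integrand is constant: the velocity is [2 pi i] times the radius
    vector. *)
Lemma integral01_circle_center (R : realType) (c : Cplx R) (r : R) : 0 < r ->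
  integral01 (fun t => (circle R c r t - c)^-1 * deriv_path (circle R c r) t)
    = two_pi_i R.
Proof.
move=> r0; rewrite (@eq_integral01 R _ (fun=> two_pi_i R)).
  rewrite /integral01 /= !Rintegral_cst//= lebesgue_measure_itv /= lte_fin ltr01.
  by rewrite -EFinB /= subr0 !mulr1.
move=> t _; rewrite deriv_path_circle.
have -> : circle R c r t - c
    = Complex (r * cos (2 * pi * t)) (r * sin (2 * pi * t)).
  by case: c => a b; apply/eqP; rewrite eq_complex /= ![_ + _ - _]addrAC !subrr
    !add0r !eqxx.
set z : Cplx R := Complex _ _.
have z0 : z != 0.
  have : `|c - circle R c r t| != 0.
    by rewrite norm_circle ?ltW// eq_complex /= negb_and lt0r_neq0.
  have -> : c - circle R c r t = - z.
    by case: c => a b; apply/eqP; rewrite eq_complex /= !opprD !addNKr !eqxx.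
  by rewrite normrN normr_eq0.
apply: (mulfI z0); rewrite mulVKf// /two_pi_i /z.
apply/eqP; rewrite eq_complex /=.
by apply/andP; split; apply/eqP; ring.
Qed.

(** * Existence of a contour around a finite set *)

(** The order of the complex numbers is partial, but moduli are real. *)
Lemma norm_le_or_lt (R : realType) (z : Cplx R) (r : R) :
  `|z| <= Complex r 0 \/ Complex r 0 < `|z|.
Proof.
by rewrite normc_def ltcR lecR; case: leP => _; [left|right].
Qed.

(** A closed disc that stays in [U] and meets [s] at most in its centre. *)
Lemma isolating_radius (R : realType) (U : set (Cplx R)) (s : seq (Cplx R)) c :
  open U -> U c ->
  exists2 r : R, 0 < r &
    forall w, `|c - w| <= Complex r 0 -> U w /\ (w \in s -> w = c).
Proof.
move=> oU Uc.
have /real_complex_nbhsP[e e0 eU] : nbhs c U by exact: open_nbhs_nbhs.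
have [r r0 rs] : exists2 r : R, 0 < r &
    forall w, w \in s -> `|c - w| <= Complex r 0 -> w = c.
  elim: s => [|a s [r r0 rs]]; first by exists 1.
  have [->|ac] := eqVneq a c.
    exists r => // w; rewrite inE => /orP[/eqP //|]; exact: rs.
  pose b := complex.Re `|c - a|.
  have bE : `|c - a| = Complex b 0 by rewrite /b normc_def.
  have b0 : 0 < b.
    have : (0 : Cplx R) < Complex b 0 by rewrite -bE normr_gt0 subr_eq0 eq_sym.
    by rewrite ltcR.
  exists (Num.min r (b / 2)); first by rewrite lt_min r0 divr_gt0.
  move=> w; rewrite inE => /orP[/eqP ->|ws].
    rewrite bE lecR le_min => /andP[_]; rewrite leNgt.
    by rewrite ltr_pdivrMr// ltr_pMr// ltr1n.
  move=> wr; apply: rs => //; apply: le_trans wr _.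
  by rewrite lecR ge_min lexx.
exists (Num.min r (e / 2)); first by rewrite lt_min r0 divr_gt0.
move=> w wr; split.
  apply: eU; apply: le_lt_trans wr _; rewrite ltcR gt_min; apply/orP; right.
  by rewrite ltr_pdivrMr// ltr_pMr// ltr1n.
by move=> ws; apply: rs => //; apply: le_trans wr _; rewrite lecR ge_min lexx.
Qed.

Lemma all_arcs_loops (R : realType) (T : eqType) (s : seq T)
    (F : T -> R -> Cplx R) (P : (R -> Cplx R) -> Prop) :
  (forall c, c \in s -> P (F c)) -> all_arcs [seq [:: F c] | c <- s] P.
Proof.
move=> sP loop; elim: s sP => [//|c s IHs] sP /= [<- g /= [<-|//]|].
  by apply: sP; rewrite mem_head.
by apply: IHs => c' c's; apply: sP; rewrite inE c's orbT.
Qed.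

(** One circle per point of [s], with radius given by [isolating_radius]: every
    other point of [s], and every point outside [U], lies outside the disc. *)
Lemma exists_surrounding_contour (R : realType) (U : set (Cplx R))
    (s : seq (Cplx R)) : open U -> [set` s] `<=` U -> uniq s ->
  exists G : contour R, surrounds U [set` s] G.
Proof.
move=> oU sU us.
have /choice[r rP] : forall c, exists r : R, c \in s -> 0 < r /\
    forall w, `|c - w| <= Complex r 0 -> U w /\ (w \in s -> w = c).
  move=> c; have [cs|_] := boolP (c \in s); last by exists 0.
  by have [r r0 rP] := isolating_radius R U s c oU (sU _ cs); exists r.
have int_outside c w : c \in s -> ~ (`|c - w| <= Complex (r c) 0) ->
    integral01 (fun t => (circle R c (r c) t - w)^-1
      * deriv_path (circle R c (r c)) t) = 0.
  move=> cs ncw; have [r0 _] := rP _ cs.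
  apply: integral01_circle_outside => //.
  by case: (norm_le_or_lt R (c - w) (r c)).
have windE w : winding [seq [:: circle R c (r c)] | c <- s] w
    = (two_pi_i R)^-1 * \sum_(c <- s) integral01 (fun t =>
        (circle R c (r c) t - w)^-1 * deriv_path (circle R c (r c)) t).
  rewrite /winding /contour_integral big_map; congr (_ * _).
  by apply: eq_bigr => c _; rewrite big_seq1.
exists [seq [:: circle R c (r c)] | c <- s]; split.
- split; first by apply: all_arcs_loops => c _; exact: circle_C1.
  by apply/allP => _ /mapP[c _ ->] /=; rewrite circle_closed eqxx.
- apply: all_arcs_loops => c cs _ [t _ <-]; have [r0 rU] := rP _ cs.
  have [|Uc cE] := rU (circle R c (r c) t).
    by rewrite norm_circle ?lexx// ltW.
  split=> // /cE cE'; have := norm_circle R c (r c) t (ltW r0).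
  by rewrite cE' subrr normr0 => -[r00]; rewrite -r00 ltxx in r0.
- move=> w ws; rewrite windE (bigD1_seq w)//= big1_seq ?addr0.
    have [r0 _] := rP _ ws.
    rewrite integral01_circle_center// mulVf//.
    have := pi_gt0 R; rewrite eq_complex /= negb_and => pi0.
    by apply/orP; right; rewrite mulf_neq0// lt0r_neq0.
  move=> c /andP[cw cs]; apply: int_outside => // cwr.
  have [_ rU] := rP _ cs; have [_ /(_ ws) wc] := rU _ cwr.
  by rewrite wc eqxx in cw.
- move=> w nUw; rewrite windE big1_seq ?mulr0// => c /andP[_ cs].
  apply: int_outside => // cwr.
  by have [_ rU] := rP _ cs; have [] := rU _ cwr.
Qed.

(** * Transfer of the functional calculus *)

Lemma cvg_calculus_integrand (C : numFieldType) (T : topologicalType) (t : T)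
    (n : nat) (B : 'M[C]_n) (f : C -> C) (g d : T -> C) :
  {for t, continuous g} -> {for t, continuous d} ->
  derivable (f : C^o -> C^o) (g t) 1 -> ~ mx_spectrum B (g t) ->
  forall i j, {for t, continuous (fun s =>
    (f (g s) *: mx_resolvent B (g s)) i j * d s)}.
Proof.
move=> cg cd df ng i j.
have FF : Filter (nbhs t) by exact: nbhs_filter.
have cR := cvg_mx_resolvent _ _ _ _ _ _ _ FF cg ng i j.
have cf : f (g s) @[s --> t] --> f (g t).
  exact: (continuous_comp cg (derivable_continuous1 _ _ _ df)).
rewrite (_ : (fun s => _) =
    (fun s => f (g s) * mx_resolvent B (g s) i j * d s)).
  exact: (cvgM (cvgM cf cR) cd).
by apply/funext => s; rewrite mxE.
Qed.

Lemma C1_path_continuous (R : realType) (g : R -> Cplx R) (t : R) :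
  C1_path g -> {for t, continuous g}.
Proof.
move=> [dRe dIm _ _].
rewrite (_ : g = fun s => Complex (complex.Re (g s)) (complex.Im (g s))).
  by apply: continuous_Complex;
    apply/differentiable_continuous/derivable1_diffP.
by apply/funext => s; case: (g s).
Qed.

Lemma C1_path_deriv_continuous (R : realType) (g : R -> Cplx R) (t : R) :
  C1_path g -> {for t, continuous (deriv_path g)}.
Proof.
move=> [_ _ cRe cIm].
exact: (continuous_Complex _ _ _ _ (cRe t) (cIm t)).
Qed.

(** The coefficients in [LiftE] do not depend on the variable of integration, so
    they come out of the contour integral. *)
Lemma calculus_integral_Lift (R : realType) (N m : nat)
    (I : 'I_m -> {set 'I_N}) (U : set (Cplx R)) (f : Cplx R -> Cplx R)
    (B : 'M[Cplx R]_m) (r : Cplx R -> 'M[Cplx R]_N) (G : contour R) :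
  (forall z, ~ mx_spectrum B z -> r z = Lift I (mx_resolvent B z)) ->
  holomorphic_on U f -> surrounds U (mx_spectrum B) G ->
  calculus_integral r f G = Lift I (calculus_integral (mx_resolvent B) f G).
Proof.
move=> rE hf [[C1G _] imG _ _].
rewrite /calculus_integral LiftZ; congr (_ *: _); apply/matrixP => i j.
rewrite mxE LiftE; under eq_bigr do rewrite mxE.
apply: contour_integral_lin => loop loopG g gloop.
have C1g := C1G _ loopG _ gloop.
have gP t : 0 <= t <= 1 -> U (g t) /\ ~ mx_spectrum B (g t).
  by move=> t01; apply: (imG _ loopG _ gloop); exists t => //=; rewrite in_itv.
split=> [t /gP[_ ng]|p].
  rewrite rE// -LiftZ LiftE; by [].
apply: continuous_integrable01 => t /gP[Ug ng].
apply: cvg_calculus_integrand => //; first exact: C1_path_continuous.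
  exact: C1_path_deriv_continuous.
exact: hf.
Qed.

(** One surrounding contour [G0] pins down both common values; when the integrals
    depend on the contour, both sides take the default 0. *)
Lemma functional_calculus_Lift (R : realType) (N m : nat)
    (I : 'I_m -> {set 'I_N}) (U K : set (Cplx R)) (f : Cplx R -> Cplx R)
    (rA : Cplx R -> 'M[Cplx R]_N) (rB : Cplx R -> 'M[Cplx R]_m) :
  block_family I -> (exists G, surrounds U K G) ->
  (forall G, surrounds U K G ->
     calculus_integral rA f G = Lift I (calculus_integral rB f G)) ->
  functional_calculus K rA U f = Lift I (functional_calculus K rB U f).
Proof.
move=> hI [G0 hG0] AB; rewrite /functional_calculus.
set SA := (X in xget 0 X = _); set SB := (X in Lift I (xget 0 X)).
have [[M SM]|nSB] := pselect (exists M, SB M).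
  have -> : xget 0 SB = M.
    by apply: xget_unique => // M' SM'; rewrite (SM _ hG0) (SM' _ hG0).
  apply: xget_unique => [G hG|M' SM']; first by rewrite AB// -(SM _ hG).
  by rewrite (SM' _ hG0) AB// -(SM _ hG0).
rewrite !xgetPN ?/Lift ?mulmx0 ?mul0mx// => M SM; apply: nSB.
  by exists M.
exists (Theta I M) => G hG.
by rewrite (SM _ hG) AB// ThetaK.
Qed.

Theorem theorem5p9 (R : realType) (N m : nat) (I : 'I_m -> {set 'I_N})
    (hN : (0 < N)%N) (hI : block_family I) :
  (forall B : 'M[Cplx R]_m,
     alg_spectrum [set: 'M[Cplx R]_m] 1%:M B = mx_spectrum B) /\
  (forall A : 'M[Cplx R]_N, Sbar R I A ->
   [/\ alg_spectrum (Sbar R I) (Sbar_unit R I) A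
         = alg_spectrum [set: 'M[Cplx R]_m] 1%:M (Theta I A),
       (forall z : Cplx R,
          ~ alg_spectrum (Sbar R I) (Sbar_unit R I) A z ->
          Theta I (alg_resolvent (Sbar R I) (Sbar_unit R I) A z)
            = mx_resolvent (Theta I A) z)
     & (forall (U : set (Cplx R)) (f : Cplx R -> Cplx R),
          open U ->
          alg_spectrum (Sbar R I) (Sbar_unit R I) A `<=` U ->
          holomorphic_on U f ->
          Sbar R I (alg_calculus (Sbar R I) (Sbar_unit R I) U f A) /\
          Theta I (alg_calculus (Sbar R I) (Sbar_unit R I) U f A)
            = mx_calculus U f (Theta I A))]).
Proof.
split=> [B|A SA]; first exact: alg_spectrum_setT.
have KE := alg_spectrum_Sbar _ _ _ _ _ hI SA.
rewrite /alg_calculus KE; split=> [|z nz|]; first exact/esym/alg_spectrum_setT.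
  by rewrite alg_resolvent_Sbar// ThetaK.
move=> U f oU KU hf.
have [s [us sE]] := mx_spectrum_seq _ _ (Theta I A).
have exG : exists G, surrounds U (mx_spectrum (Theta I A)) G.
  by rewrite sE in KU *; exact: exists_surrounding_contour.
have -> : functional_calculus (mx_spectrum (Theta I A))
    (alg_resolvent (Sbar R I) (Sbar_unit R I) A) U f
    = Lift I (mx_calculus U f (Theta I A)).
  apply: functional_calculus_Lift => // G hG.
  apply: (calculus_integral_Lift _ _ _ I U) => // z.
  exact: alg_resolvent_Sbar.
split; last exact: ThetaK.
by apply/SbarE => //; exact: Lift_block_constant.
Qed.
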